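(* For every integer $k$ there exists a modular knot $K$ such that $k$ is one of the coefficients of the Alexander polynomial $\Delta_K(t)$.
   Context: Words: let $\{L,R\}^*_{\mathrm{prim}}$ be the set of finite nonempty words over the alphabet $\{L,R\}$ that are primitive (not of the form $U^k$ for a shorter word $U$ and $k\ge 2$). Let $\mathrm{cyc}$ move the first letter of a word to the end. For $W\in\{L,R\}^*_{\mathrm{prim}}$ of length $m\ge 2$, for $1\le j\le m$ let $\mathrm{rank}_j(W)\in\{1,\dots,m\}$ be the rank of $\mathrm{cyc}^{j-1}(W)$ among all (distinct) cyclic permutations of $W$ in ascending lexicographic order with $L<R$, and put $\mathrm{rank}_{m+1}(W)=\mathrm{rank}_1(W)$. The modular braid $\mathbb{M}(W)$ is the $m$-strand braid joining, for each $1\le j\le m$, the $\mathrm{rank}_j(W)$-th top point to the $\mathrm{rank}_{j+1}(W)$-th bottom point by a straight segment, where at each crossing the strand starting at a top point whose cyclic permutation begins with $L$ passes over the strand starting at a top point whose cyclic permutation begins with $R$. A modular knot is the closure of $\mathbb{M}(W)$ for some $W\in\{L,R\}^*_{\mathrm{prim}}$ of length at least $2$. For a knot $K$, $\Delta_K(t)$ denotes its Alexander polynomial, normalized (by multiplication by a unit $\pm t^k$) to be a polynomial in $\mathbb{Z}[t]$ with nonzero constant term and $\Delta_K(1)=1$; ''coefficient'' means the coefficient of some power $t^d$, $0\le d\le \deg\Delta_K$. *)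

(* Defs.v *)
From HB Require Import structures.
From mathcomp Require Import all_boot all_order all_algebra.
From mathcomp Require Import fraction.
Set Implicit Arguments. Unset Strict Implicit. Unset Printing Implicit Defensive.
Import Order.TTheory GRing.Theory Num.Theory.

(* Words over {L,R}: L = false, R = true (so L < R as false < true). *)
Definition word := seq bool.

Definition primitive (W : word) : Prop :=
  W <> [::] /\ forall (U : word) (k : nat), 2 <= k -> W <> flatten (nseq k U).

Fixpoint lexlt (u v : word) : bool :=
  match u, v with
  | [::], [::] => false
  | [::], _ :: _ => true
  | _ :: _, [::] => false
  | a :: u', b :: v' => (~~ a && b) || ((a == b) && lexlt u' v')
  end.

(* cyc^j W = rot j W.  0-based rank of cyc^j W among the (distinct, W being
   primitive) cyclic permutations rot 0 W, ..., rot (m-1) W. *)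
Definition rank0 (W : word) (j : nat) : nat :=
  count (fun i => lexlt (rot i W) (rot j W)) (iota 0 (size W)).

(* Strand j (0 <= j < m) goes from top point rank0 W j to bottom point
   rank0 W (j+1 mod m); it starts at a top point whose cyclic permutation
   begins with letter nth false W j. *)
Definition strand_top (W : word) (j : nat) := rank0 W j.
Definition strand_bot (W : word) (j : nat) := rank0 W ((j.+1) %% size W).
Definition strand_isL (W : word) (j : nat) : bool := ~~ nth false W j.

(* One bubble-sort pass on the left-to-right list of strands, starting at
   position k.  Each swap of adjacent strands at positions (k, k+1) records the
   Artin generator sigma_k^{+1} if the left strand passes over the right one
   (left strand begins with L), and sigma_k^{-1} otherwise. *)
Fixpoint bubble_pass_from (W : word) (k : nat) (x : nat) (t : seq nat)
  : seq nat * seq (nat * bool) :=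
  match t with
  | [::] => ([:: x], [::])
  | y :: t' =>
      if strand_bot W y < strand_bot W x then
        let: (s', w) := bubble_pass_from W k.+1 x t' in
        (y :: s', (k, strand_isL W x) :: w)
      else
        let: (s', w) := bubble_pass_from W k.+1 y t' in (x :: s', w)
  end.

Definition bubble_pass (W : word) (k : nat) (s : seq nat) : seq nat * seq (nat * bool) :=
  match s with
  | [::] => ([::], [::])
  | x :: t => bubble_pass_from W k x t
  end.

Fixpoint bubble_iter (W : word) (n : nat) (s : seq nat) : seq (nat * bool) :=
  match n with
  | 0 => [::]
  | n'.+1 => let: (s', w) := bubble_pass W 0 s in w ++ bubble_iter W n' s'
  end.

Definition top_order (W : word) : seq nat :=
  sort (fun a b => strand_top W a <= strand_top W b) (iota 0 (size W)).

(* The modular braid M(W) as a word in the Artin generators (read top to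
   bottom): (k, true) = sigma_k, (k, false) = sigma_k^{-1}, 0 <= k < m-1. *)
Definition modular_braid (W : word) : seq (nat * bool) :=
  bubble_iter W (size W) (top_order W).

(* Laurent polynomials are computed in the fraction field of Z[t]. *)
Definition F := {fraction {poly int}}.
Definition tF : F := FracField.tofrac ('X : {poly int}).
Definition polyF (p : {poly int}) : F := FracField.tofrac p.

Local Open Scope ring_scope.

(* Unreduced Burau matrix of sigma_k^{+-1} on m strands:
   sigma_k    |-> I + block [[1-t, t], [1, 0]] at rows/cols k, k+1
   sigma_k^-1 |-> I + block [[0, 1], [t^-1, 1-t^-1]]. *)
Definition burau_gen (m : nat) (g : nat * bool) : 'M[F]_m :=
  let: (k, pos) := g in
  \matrix_(i < m, j < m)
    if (i == k :> nat) && (j == k :> nat) then (if pos then 1 - tF else 0)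
    else if (i == k :> nat) && (j == k.+1 :> nat) then (if pos then tF else 1)
    else if (i == k.+1 :> nat) && (j == k :> nat) then (if pos then 1 else tF^-1)
    else if (i == k.+1 :> nat) && (j == k.+1 :> nat) then (if pos then 0 else 1 - tF^-1)
    else if i == j then 1 else 0.

Definition burau (m : nat) (b : seq (nat * bool)) : 'M[F]_m :=
  foldl (fun M g => M *m burau_gen m g) 1%:M b.

(* Alexander matrix of the closed braid (Fox calculus on the presentation
   <x_1..x_m | x_i = beta(x_i)>, abelianized): I - Burau(beta).
   Deleting one relation and one generator (the last ones) gives a
   determinant equal to the Alexander polynomial up to units +-t^n. *)
Definition alex_det (W : word) : F :=
  let m := size W in
  let A := (1%:M - burau m (modular_braid W)) : 'M[F]_m in
  \det (\matrix_(i < m.-1, j < m.-1)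
          A (widen_ord (leq_pred m) i) (widen_ord (leq_pred m) j)).

Definition is_alexander_poly (W : word) (p : {poly int}) : Prop :=
  p.[0] != 0 /\ p.[1] = 1 /\
  exists (e : bool) (n : int), alex_det W = (-1) ^+ e * tF ^ n * polyF p.

(* Main.v *)
(* Sorting the strands of a modular braid produces positive crossings only, since only an
   L strand crosses an R strand, and the Burau matrix of such a braid is Jones' bowling ball
   walk: a ball on an L strand falls onto each strand passing below it with weight [1 - t],
   while a ball on an R strand never falls. Conversely, a cyclic permutation increasing on
   its first p points and on the others is the permutation of the modular braid of the
   itinerary of any of its points, because cyclic shifts of the itinerary are ordered as the
   points of the orbit.

   For k > 0, twisting the first three strands of the torus knot T(6, 6k + 1) by 2k full
   twists gives such a permutation of 12k + 7 points. Its L strands pass over the first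
   three or over all six of the R strands, so I minus the Burau matrix is a unipotent matrix
   plus a matrix of rank 2, and its minor is a 2 x 2 determinant. With
   K = 1 + t^6 + ... + t^(6(k-1)), this gives the Alexander polynomial
   (1 - t) K + t^(6k) ((t - t^2) K + (1 - t)^2 (1 + t^3) K^2) modulo t^(12k),
   and the coefficient of t^(6(k-1)) in K^2 is k. *)

Require Import Defs.
From mathcomp Require Import all_boot all_order all_algebra.
From mathcomp Require Import fingroup perm fraction.
From mathcomp Require Import zify ring.

Set Implicit Arguments. Unset Strict Implicit. Unset Printing Implicit Defensive.
Import Order.TTheory GRing.Theory Num.Theory.

(** * Burau matrices of modular braids *)

Local Open Scope ring_scope.

(* Jones' bowling ball: rolling down strand [x], it falls onto each strand [y] passing
   under [x] with weight [1 - t]; [phi] is read off at the bottom point reached. *)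
Fixpoint ball (bot : nat -> nat) (phi : nat -> F) x (s : seq nat) : F :=
  if s is y :: s' then
    if (bot y < bot x)%N then (1 - tF) * phi (bot y) + tF * ball bot phi x s'
    else ball bot phi x s'
  else phi (bot x).

Fixpoint ball_at (bot : nat -> nat) (phi : nat -> F) (s : seq nat) i : F :=
  match s, i with
  | [::], _ => 0
  | x :: s', 0 => ball bot phi x s'
  | x :: s', i'.+1 => ball_at bot phi s' i'
  end.

Lemma ball_nocross bot phi x s :
  all (fun y => bot x <= bot y)%N s -> ball bot phi x s = phi (bot x).
Proof. by elim: s => //= y s IH /andP[]; rewrite leqNgt => /negbTE-> /IH. Qed.

Lemma ball_cat_nocross bot phi x s1 s2 :
  all (fun y => bot x <= bot y)%N s1 -> ball bot phi x (s1 ++ s2) = ball bot phi x s2.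
Proof. by elim: s1 => //= y s IH /andP[]; rewrite leqNgt => /negbTE-> /IH. Qed.

Lemma ball_map (f g r : nat -> nat) phi x s : {in x :: s, forall y, f y = g (r y)} ->
  ball f phi x s = ball g phi (r x) (map r s).
Proof.
elim: s => [|y s IH] H /=; first by rewrite H ?mem_head.
rewrite IH => [|w ws]; first by rewrite !H ?mem_head // inE mem_head orbT.
by apply: H; move: ws; rewrite !inE => /orP[->|->]; rewrite ?orbT.
Qed.

Lemma ball_at_nth bot phi s i : (i < size s)%N ->
  ball_at bot phi s i = ball bot phi (nth 0%N s i) (drop i.+1 s).
Proof. by elim: s i => // x s IH [|i] /= h; rewrite ?drop0 // IH. Qed.

Local Close Scope ring_scope.

Section BubbleSort.
Variable W : word.
Local Notation bot := (strand_bot W).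
Local Notation isL := (strand_isL W).
Local Notation pass := (bubble_pass_from W).

Lemma bubble_pass_from_cons k x y t :
  pass k x (y :: t) =
  if bot y < bot x then (y :: (pass k.+1 x t).1, (k, isL x) :: (pass k.+1 x t).2)
  else (x :: (pass k.+1 y t).1, (pass k.+1 y t).2).
Proof. by rewrite /=; case: ifP => _; case: bubble_pass_from. Qed.

Lemma bubble_pass_from_perm k x t : perm_eq (pass k x t).1 (x :: t).
Proof.
elim: t k x => // y t IH k x; rewrite bubble_pass_from_cons.
case: ifP => _ /=; last by rewrite perm_cons.
have := IH k.+1 x; rewrite -(perm_cons y) => /perm_trans; apply.
exact/permPl/(perm_catCA [:: y] [:: x] t).
Qed.

Lemma bubble_pass_from_sorted k x b : all (fun y => bot x <= bot y) b ->
  sorted leq (map bot b) -> (pass k x b).1 = x :: b.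
Proof.
elim: b k x => // y b IH k x; rewrite bubble_pass_from_cons /= => /andP[xy xb] sb.
rewrite ltnNge xy /= IH ?(path_sorted sb) //.
by move: sb; rewrite (path_sortedE leq_trans) all_map => /andP[].
Qed.

(** A pass carries along the strand with the farthest bottom point met so far, so it sets down a
    maximum [c] of the prefix just before the sorted [b]. *)
Lemma bubble_pass_from_cat k x a b :
  all (fun z => all (fun y => bot z <= bot y) b) (x :: a) -> sorted leq (map bot b) ->
  exists a' c, [/\ (pass k x (a ++ b)).1 = a' ++ c :: b, size a' = size a,
    perm_eq (rcons a' c) (x :: a) & all (fun z => bot z <= bot c) (x :: a)].
Proof.
move=> + sb; elim: a k x => [|y a IH] k x /=.
  by rewrite andbT => xb; exists [::], x; rewrite /= leqnn bubble_pass_from_sorted.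
case/and3P=> xb yb ab; rewrite -/(bubble_pass_from _ _ _ (y :: (a ++ b))) bubble_pass_from_cons.
case: ltnP => xy /=.
  have [|a' [c [-> sz pm /= /andP[xc ac]]]] := IH k.+1 x; first by rewrite /= xb.
  exists (y :: a'), c; rewrite /= sz xc ac (leq_trans (ltnW xy) xc); split=> //.
  move: pm; rewrite -(perm_cons y) => /perm_trans; apply.
  exact/permPl/(perm_catCA [:: y] [:: x] a).
have [|a' [c [-> sz pm /= /andP[yc ac]]]] := IH k.+1 y; first by rewrite /= yb.
by exists (x :: a'), c; rewrite /= sz yc ac (leq_trans xy yc) perm_cons.
Qed.

Lemma bubble_iter_sorted n s : size s = n ->
  sorted leq (map bot (iter n (fun s => (bubble_pass W 0 s).1) s)).
Proof.
(* After [i] passes, the last [i] strands are sorted and bound all the others. *)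
move=> szs; pose P i s := exists a b, [/\ s = a ++ b, size a = n - i,
  all (fun z => all (fun y => bot z <= bot y) b) a & sorted leq (map bot b)].
suff /(_ n (leqnn n)) : forall i, i <= n -> P i (iter i (fun s => (bubble_pass W 0 s).1) s).
  by case=> a [b [-> sza _ sb]]; have /size0nil -> : size a = 0 by lia.
elim=> [|i IH] lein.
  by exists s, [::]; rewrite cats0 subn0; split=> //; apply/allP.
have /= [[|x a] [b [-> sza ab sb]]] := IH (ltnW lein); first by move: sza => /=; lia.
have [a' [c [-> sz pm xc]]] := bubble_pass_from_cat 0 ab sb.
exists a', (c :: b); split=> //; first by move: sza => /=; lia.
  apply/allP => z za'; have zxa : z \in x :: a.
    by rewrite -(perm_mem pm) mem_rcons inE za' orbT.
  by rewrite /= (allP xc _ zxa) (allP ab _ zxa).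
rewrite /= (path_sortedE leq_trans) sb all_map andbT.
by apply: (allP ab); rewrite -(perm_mem pm) mem_rcons mem_head.
Qed.

(* In a Lorenz braid only an L strand followed by an R strand may still have to cross. *)
Definition only_LR_cross x y := (bot y < bot x) ==> (isL x && ~~ isL y).
Local Notation inv := (pairwise only_LR_cross).

(** A pass exchanges only pairs that have to cross, and an exchanged pair no longer does. *)
Lemma pairwise_bubble_pass_from k x t : inv (x :: t) -> inv (pass k x t).1.
Proof.
elim: t k x => // y t IH k x; rewrite bubble_pass_from_cons.
rewrite [inv _]/= => /andP[/andP[xy xt] /andP[yt tt]].
case: ifP => bxy.
  rewrite /= (perm_all _ (bubble_pass_from_perm _ _ _)) /= yt IH /= ?xt ?tt //.
  by rewrite /only_LR_cross ltnNge ltnW.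
by rewrite /= (perm_all _ (bubble_pass_from_perm _ _ _)) /= xy xt IH /= ?yt.
Qed.

Local Open Scope ring_scope.
Variable phi : nat -> F.

Local Notation ball := (ball bot phi).
Local Notation ball_at := (ball_at bot phi).

(** A strand that moves right in a pass begins with [L], so [x] does not pass over it; the strands
    that [x] does pass over keep their order. *)
Lemma ball_pass x k y t : inv [:: x, y & t] -> ball x (pass k y t).1 = ball x (y :: t).
Proof.
elim: t k y => // w t IH k y; rewrite bubble_pass_from_cons.
rewrite [inv _]/= => /andP[/and3P[xy xw xt] /andP[/andP[yw yt] /andP[wt tt]]].
case: ifP => bwy; last by rewrite [LHS]/= (IH k.+1 w) //= xw xt wt.
rewrite [LHS]/= IH; last by rewrite /= xy xt yt.
have bxy : (bot y < bot x)%N = false.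
  apply/negbTE/negP => h; move: yw xy; rewrite /only_LR_cross bwy h /=.
  by move=> /andP[-> _]; rewrite andbF.
by rewrite /= bxy.
Qed.

(** The Burau matrix of the positive generator [sigma_k], acting on columns indexed by [nat]. *)
Definition burau_act k (psi : nat -> F) i : F :=
  if i == k then (1 - tF) * psi k + tF * psi k.+1
  else if i == k.+1 then psi k else psi i.

Definition burau_word_act (b : seq (nat * bool)) (psi : nat -> F) :=
  foldr (fun g => burau_act g.1) psi b.

(** Row [k] of a generator is the rule of the bowling ball at one crossing: fall onto [y] with
    weight [1 - tF], ride on with weight [tF]. By the first conclusion this row reads [psi k]
    itself, which the later swaps of the pass leave alone. *)
Lemma burau_word_act_pass k x t psi : inv (x :: t) ->
  (forall i, (i <= size t)%N -> psi (k + i)%N = ball_at (pass k x t).1 i) ->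
  (forall i, (i < k)%N -> burau_word_act (pass k x t).2 psi i = psi i) /\
  forall i, (i <= size t)%N ->
    burau_word_act (pass k x t).2 psi (k + i)%N = ball_at (x :: t) i.
Proof.
elim: t k x => [|y t IH] k x ixt H; first by split=> // i h; rewrite /= H.
have ixt' := ixt; move: H; rewrite bubble_pass_from_cons.
move: ixt => /=/andP[/andP[xy xt] /andP[yt tt]].
case: ifP => bxy H; last first.
  have H1 i : (i <= size t)%N -> psi (k.+1 + i)%N = ball_at (pass k.+1 y t).1 i.
    by move=> it; rewrite addSnnS H.
  have [IH1 IH2] := IH _ _ (introT andP (conj yt tt)) H1.
  split=> [i ik|[|i] it]; first by rewrite IH1 // ltnW.
    rewrite addn0 IH1 // -[k]addn0 H //= ball_pass //.
    by rewrite /= bxy.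
  by rewrite addnS -addSn IH2.
have H1 i : (i <= size t)%N -> psi (k.+1 + i)%N = ball_at (pass k.+1 x t).1 i.
  by move=> it; rewrite addSnnS H.
have [IH1 IH2] := IH _ _ (introT andP (conj xt tt)) H1.
have yR : ~~ isL y by move: xy; rewrite /only_LR_cross bxy => /andP[].
have ynocross : all (fun w => bot y <= bot w)%N t.
  apply/allP => w /(allP yt); rewrite /only_LR_cross (negbTE yR) /= implybF.
  by rewrite -leqNgt.
(* The strand [y] begins with [R]: its ball never falls, in whatever order the pass leaves the
   strands to its right. *)
have psik : psi k = phi (bot y).
  rewrite -[k]addn0 H //= ball_nocross // (perm_all _ (bubble_pass_from_perm _ _ _)) /=.
  by rewrite ynocross ltnW.
split=> [i ik|i it].
  by rewrite /= /burau_act !ltn_eqF ?IH1 //; lia.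
rewrite /= /burau_act (IH1 k) //; case: i it => [|[|i]] it.
- by rewrite addn0 eqxx psik; have := IH2 0 isT; rewrite addn0 => ->.
- by rewrite addn1 eqxx gtn_eqF // psik ball_nocross.
- have -> : (k + i.+2 = k.+1 + i.+1)%N by lia.
  by rewrite !gtn_eqF ?IH2 //; lia.
Qed.

Lemma bubble_pass_from_gens m k x t : inv (x :: t) -> (k + size t < m)%N ->
  all (fun g => g.2 && (g.1.+1 < m)%N) (pass k x t).2.
Proof.
elim: t k x => // y t IH k x; rewrite bubble_pass_from_cons.
move=> /=/andP[/andP[xy xt] /andP[yt tt]] ktm.
case: ifP => bxy /=; rewrite IH //= ?xt ?yt ?tt //; try lia.
by move: xy; rewrite /only_LR_cross bxy => /andP[-> _]; lia.
Qed.

Lemma bubble_iter_gens m n s : inv s -> (size s <= m)%N ->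
  all (fun g => g.2 && (g.1.+1 < m)%N) (bubble_iter W n s).
Proof.
elim: n s => // n IH [|x t] invs szs.
  by rewrite /=; apply: (IH [::]).
have invp := pairwise_bubble_pass_from 0 invs.
have szp := perm_size (bubble_pass_from_perm 0 x t).
have := @bubble_pass_from_gens m 0 x t invs szs.
rewrite /bubble_iter -/bubble_iter /bubble_pass; case E: (bubble_pass_from _ _ _ _) => [s' w] /= Hw.
by rewrite all_cat Hw IH //; move: invp szp; rewrite E /= => ? // ->.
Qed.

Lemma burau_word_act_iter n s :
  inv s -> perm_eq (map bot s) (iota 0 (size s)) ->
  sorted leq (map bot (iter n (fun s => (bubble_pass W 0 s).1) s)) ->
  forall i, (i < size s)%N -> burau_word_act (bubble_iter W n s) phi i = ball_at s i.
Proof.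
elim: n s => [|n IH] s invs ps.
  (* Once sorted, the strands no longer cross and the [i]-th one ends at bottom point [i]. *)
  move=> /= ss; have E : map bot s = iota 0 (size s).
    apply: (@sorted_eq _ leq) => //; first exact: leq_trans.
      by move=> x y; rewrite -eqn_leq => /eqP.
    exact: iota_sorted.
  suff H k : map bot s = iota k (size s) ->
    forall i, (i < size s)%N -> phi (k + i)%N = ball_at s i by exact: (H 0).
  elim: s k {ss E ps invs} => // x s IHs k /= [bx E] [|i] ilt.
    rewrite ball_nocross ?bx ?addn0 //; apply/allP => y ys.
    have : bot y \in map bot s by rewrite map_f.
    by rewrite E mem_iota => /andP[/ltnW].
  by rewrite -addSnnS IHs.
case: s invs ps => // x t invs ps; rewrite iterSr [bubble_pass _ _ _]/= => ss i ilt.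
have pp := bubble_pass_from_perm 0 x t.
have szp := perm_size pp.
have invp := pairwise_bubble_pass_from 0 invs.
have psp : perm_eq (map bot (pass 0 x t).1) (iota 0 (size (pass 0 x t).1)).
  by rewrite szp; apply: perm_trans (perm_map _ pp) ps.
have H := IH _ invp psp ss; rewrite szp in H.
have -> : bubble_iter W n.+1 (x :: t) = (pass 0 x t).2 ++ bubble_iter W n (pass 0 x t).1.
  by rewrite [LHS]/=; case: (bubble_pass_from _ _ _ _).
rewrite /burau_word_act foldr_cat -!/(burau_word_act _ _).
by have [_ ->] := burau_word_act_pass invs H.
Qed.

End BubbleSort.

Local Open Scope ring_scope.

Lemma burau_gen_col m k (psi : nat -> F) : (k.+1 < m)%N ->
  burau_gen m (k, true) *m \col_i psi i = \col_i burau_act k psi i.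
Proof.
move=> km; apply/matrixP => i c; rewrite !mxE.
have km' := ltnW km; pose K := Ordinal km'; pose K1 := Ordinal km.
have KK1 : K1 != K by rewrite -val_eqE /= gtn_eqF.
case: (altP (i =P K)) => [->|iK].
  rewrite (bigD1 K) //= (bigD1 K1) //= big1 => [|j /andP[jK jK1]].
    by rewrite !mxE /burau_act /= !eqxx /= gtn_eqF // addr0.
  rewrite !mxE [K == j]eq_sym (negbTE jK) /=; move: jK jK1.
  by rewrite -!val_eqE /= => /negbTE-> /negbTE->; rewrite !andbF mul0r.
case: (altP (i =P K1)) => [->|iK1].
  rewrite (bigD1 K) //= big1 => [|j jK].
    by rewrite !mxE /burau_act /= !eqxx /= gtn_eqF // mul1r addr0.
  rewrite !mxE /= eqxx gtn_eqF //= -[_ == j]val_eqE /=.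
  move: jK; rewrite -!val_eqE /= => /negbTE->.
  by case: (eqVneq (val j) k.+1) => h; rewrite ?mul0r // eq_sym (negbTE h) mul0r.
move: iK iK1; rewrite -!val_eqE /= => iK iK1.
rewrite (bigD1 i) //= big1 => [|j ji].
  by rewrite !mxE /burau_act /= (negbTE iK) (negbTE iK1) /= eqxx mul1r addr0.
by rewrite !mxE (negbTE iK) (negbTE iK1) /= eq_sym (negbTE ji) mul0r.
Qed.

Lemma burau_col m b (psi : nat -> F) : all (fun g => g.2 && (g.1.+1 < m)%N) b ->
  burau m b *m \col_i psi i = \col_i burau_word_act b psi i.
Proof.
rewrite /burau => Hb.
have aux (M : 'M_m) : foldl (fun M g => M *m burau_gen m g) M b *m \col_i psi i =
    M *m \col_i burau_word_act b psi i.
  elim: b M Hb => // -[k e] b IH M /= /andP[/andP[-> km] /IH->].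
  by rewrite -mulmxA burau_gen_col.
by rewrite aux mul1mx.
Qed.

Local Close Scope ring_scope.

(** * Words from cyclic permutations *)

Lemma lexlt_irr u : lexlt u u = false.
Proof. by elim: u => //= a u ->; rewrite eqxx; case: a. Qed.

Lemma lexlt_asym u v : lexlt u v -> ~~ lexlt v u.
Proof.
elim: u v => [|a u IH] [|b v] //= /orP[/andP[]|/andP[/eqP-> /IH/negbTE->]].
  by case: a; case: b.
by rewrite andbF andNb.
Qed.

Section LorenzPermutation.
Variables (m p z : nat) (S tau : nat -> nat).
Hypothesis z_lt : z < m.
Hypothesis S_lt : forall x, x < m -> S x < m.
Hypothesis S_monoL : forall x y, x < y -> y < p -> S x < S y.
Hypothesis S_monoR : forall x y, p <= x -> x < y -> y < m -> S x < S y.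
Hypothesis tau_lt : forall x, x < m -> tau x < m.
Hypothesis tau_z : tau z = 0.
Hypothesis tau_S : forall x, x < m -> S x != z -> tau (S x) = (tau x).+1.
Hypothesis tau_last : forall x, x < m -> S x = z -> tau x = m.-1.

Definition orbit_pos j := iter j S z.

Definition itinerary x n : word := mkseq (fun i => p <= iter i S x) n.

Lemma orbit_pos_lt j : orbit_pos j < m.
Proof. by elim: j => //= j; apply: S_lt. Qed.

(** [tau] is a clock: it shows 0 at [z], advances by one with [S], and lets [S] return to [z] only
    at time [m.-1]. This certifies that [S] is a single cycle. *)
Lemma tau_orbit j : j < m -> tau (orbit_pos j) = j.
Proof.
elim: j => // j IH ltjm; have tj := IH (ltnW ltjm).
rewrite /= tau_S ?tj ?orbit_pos_lt //; apply/eqP=> Sz.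
by have := tau_last (orbit_pos_lt j) Sz; rewrite tj; lia.
Qed.

(** Otherwise the clock would reach [m], against [tau_lt]. *)
Lemma orbit_pos_period : orbit_pos m = z.
Proof.
have m_gt0 : 0 < m by lia.
rewrite -(prednK m_gt0) [LHS]/=; apply/eqP/negPn/negP => neq.
have lt1 := orbit_pos_lt m.-1.
have := tau_lt (S_lt lt1); rewrite tau_S // tau_orbit; lia.
Qed.

Lemma orbit_pos_mod j : orbit_pos (j %% m) = orbit_pos j.
Proof.
rewrite [in RHS](divn_eq j m); elim: (j %/ m) => [|q IH]; first by rewrite mul0n.
by rewrite mulSn -addnA addnC /orbit_pos iterD -!/(orbit_pos _) orbit_pos_period.
Qed.

Lemma orbit_pos_inj : {in gtn m &, injective orbit_pos}.
Proof. by move=> i j ilt jlt eq; rewrite -(tau_orbit ilt) eq tau_orbit. Qed.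

Lemma orbit_pos_perm : perm_eq (map orbit_pos (iota 0 m)) (iota 0 m).
Proof.
have u : uniq (map orbit_pos (iota 0 m)).
  by rewrite map_inj_in_uniq ?iota_uniq // => i j; rewrite !mem_iota; apply: orbit_pos_inj.
apply: uniq_perm; rewrite ?iota_uniq //.
apply: (uniq_min_size u _ _).2 => //; last by rewrite size_map.
by move=> _ /mapP[j _ ->]; rewrite mem_iota orbit_pos_lt.
Qed.

Lemma orbit_surj x : x < m -> exists2 j, j < m & x = orbit_pos j.
Proof.
move=> xm; have : x \in map orbit_pos (iota 0 m).
  by rewrite (perm_mem orbit_pos_perm) mem_iota.
by case/mapP => j; rewrite mem_iota => jm ->; exists j.
Qed.

(* Orbits [x < y] with equal itineraries would stay in this order all along the
   cycle, so [y] would jump past the largest position when [x] reaches it. *)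
Lemma itinerary_mono_aux x y n : x < y -> y < m ->
  (exists2 i, i < n & iter i S x = m.-1) -> lexlt (itinerary x n) (itinerary y n).
Proof.
elim: n x y => [|n IH] x y xy ym [i] // ilt Ex.
have itS w : itinerary w n.+1 = (p <= w) :: itinerary (S w) n.
  rewrite /itinerary /mkseq /= -[1]/(1 + 0) iotaDl -map_comp; congr (_ :: _).
  by apply: eq_map => j /=; rewrite -iterSr.
rewrite !itS /=; case: i ilt Ex => [|i] ilt Ex; first by move: Ex => /=; lia.
have tl : S x < S y -> lexlt (itinerary (S x) n) (itinerary (S y) n).
  move=> Sxy; apply: IH => //; first exact: S_lt.
  by exists i; rewrite // -Ex iterSr.
case: (leqP p x) => px; last case: (leqP p y) => py //=.
  by rewrite (leq_trans px (ltnW xy)) tl //; apply: S_monoR.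
by rewrite tl //; apply: S_monoL.
Qed.

Definition orbit_word := itinerary z m.

Lemma size_orbit_word : size orbit_word = m.
Proof. exact: size_mkseq. Qed.

Lemma nth_orbit_word j : j < m -> nth false orbit_word j = (p <= orbit_pos j).
Proof. exact: nth_mkseq. Qed.

Lemma rot_orbit_word j : j < m -> rot j orbit_word = itinerary (orbit_pos j) m.
Proof.
move=> jm; apply: (@eq_from_nth _ false) => [|i]; first by rewrite size_rot !size_mkseq.
rewrite size_rot size_orbit_word => im; rewrite nth_mkseq // -iterD -/(orbit_pos _).
have -> : nth false (rot j orbit_word) i = nth false orbit_word ((i + j) %% m).
  rewrite /rot nth_cat size_drop size_orbit_word; case: ltnP => h.
    by rewrite nth_drop addnC modn_small //; lia.
  rewrite nth_take; last by lia.
  have -> : i + j = (i - (m - j)) + m by lia.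
  by rewrite modnDr modn_small //; lia.
by rewrite nth_orbit_word ?orbit_pos_mod // ltn_mod; lia.
Qed.

Lemma lexlt_rot_orbit_word i j : i < m -> j < m ->
  lexlt (rot i orbit_word) (rot j orbit_word) = (orbit_pos i < orbit_pos j).
Proof.
move=> im jm; rewrite !rot_orbit_word //.
have aux x y : x < y -> y < m -> lexlt (itinerary x m) (itinerary y m).
  move=> xy ym; apply: itinerary_mono_aux => //.
  have [a am ->] := orbit_surj (ltn_trans xy ym).
  have [b bm ->] : exists2 b, b < m & m.-1 = orbit_pos b by apply: orbit_surj; lia.
  (* The number of steps from time [a] to time [b] around the cycle. *)
  exists ((b + (m - a)) %% m); first by rewrite ltn_mod; lia.
  rewrite -iterD -/(orbit_pos _) -orbit_pos_mod modnDml -addnA subnK; last exact: ltnW.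
  by rewrite modnDr modn_small.
case: ltngtP => [lt|gt|->]; last by rewrite lexlt_irr.
  by rewrite aux // orbit_pos_lt.
by apply/negbTE/lexlt_asym/aux => //; apply: orbit_pos_lt.
Qed.

(** Rotations are ordered as the points of the orbit, and these fill [0, ..., m - 1], so each point
    has as many points below it as its own value. *)
Lemma rank0_orbit_word j : j < m -> rank0 orbit_word j = orbit_pos j.
Proof.
move=> jm; rewrite /rank0 size_orbit_word.
rewrite (@eq_in_count _ _ (preim orbit_pos (gtn (orbit_pos j)))); last first.
  by move=> i; rewrite mem_iota => im /=; apply: lexlt_rot_orbit_word.
rewrite -count_map (seq.permP orbit_pos_perm) -size_filter.
have := orbit_pos_lt j => lt.
have -> : iota 0 m = iota 0 (orbit_pos j) ++ iota (orbit_pos j) (m - orbit_pos j).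
  by rewrite -{2}[orbit_pos j]add0n -iotaD subnKC // ltnW.
rewrite filter_cat (@eq_in_filter _ _ predT) ?filter_predT; last first.
  by move=> x; rewrite mem_iota /= => ->.
rewrite (@eq_in_filter _ _ pred0) ?filter_pred0 ?cats0 ?size_iota //.
by move=> x; rewrite mem_iota /=; lia.
Qed.

(** A power of [U] is fixed by the rotation through [size U], whereas rotations at distinct times
    below [m] belong to distinct points and compare strictly. *)
Lemma orbit_word_primitive : primitive orbit_word.
Proof.
split=> [|U k k2 E]; first by move/(congr1 size); rewrite size_orbit_word /=; lia.
have sz : size orbit_word = k * size U.
  by rewrite E size_flatten /shape map_nseq sumn_nseq mulnC.
rewrite size_orbit_word in sz.
have Um : size U < m by move: z_lt; rewrite sz; nia.
have U0 : 0 < size U by move: z_lt; rewrite sz; nia.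
have rotU : rot (size U) orbit_word = orbit_word.
  have comm : forall n, U ++ flatten (nseq n U) = flatten (nseq n U) ++ U.
    by elim=> [|n IH] /=; rewrite ?cats0 // IH catA IH.
  by case: k k2 E sz => // k _ -> _; rewrite /= rot_size_cat comm.
have m0 : 0 < m by lia.
have := @lexlt_rot_orbit_word 0 (size U) m0 Um.
have := @lexlt_rot_orbit_word (size U) 0 Um m0.
rewrite rot0 rotU lexlt_irr => /esym h1 /esym h2.
have /orbit_pos_inj : orbit_pos 0 = orbit_pos (size U) by lia.
by rewrite !inE => /(_ m0 Um); lia.
Qed.

Lemma strand_bot_orbit_word j : j < m -> strand_bot orbit_word j = S (orbit_pos j).
Proof.
move=> jm; rewrite /strand_bot size_orbit_word rank0_orbit_word ?orbit_pos_mod //.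
by rewrite ltn_mod; lia.
Qed.

Lemma strand_isL_orbit_word j : j < m -> strand_isL orbit_word j = (orbit_pos j < p).
Proof. by move=> jm; rewrite /strand_isL nth_orbit_word // -ltnNge. Qed.

Lemma map_orbit_pos_top_order : map orbit_pos (top_order orbit_word) = iota 0 m.
Proof.
rewrite /top_order size_orbit_word.
set s := sort _ _.
have ps : perm_eq s (iota 0 m) by rewrite perm_sort.
apply: (@sorted_eq _ leq); first exact: leq_trans.
- by move=> x y; rewrite -eqn_leq => /eqP.
- rewrite sorted_map.
  have : sorted (fun a b => strand_top orbit_word a <= strand_top orbit_word b) s.
    by apply: sort_sorted => a b; apply: leq_total.
  have ins : {in s, forall x, x < m} by move=> x; rewrite (perm_mem ps) mem_iota.
  rewrite (@eq_in_sorted _ (gtn m) _ (relpre orbit_pos leq)) //.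
    by move=> a b am bm /=; rewrite /strand_top !rank0_orbit_word.
  by apply/allP => x /ins.
- exact: iota_sorted.
- exact: perm_trans (perm_map _ ps) orbit_pos_perm.
Qed.

Lemma mem_top_order j : (j \in top_order orbit_word) = (j < m).
Proof. by rewrite mem_sort mem_iota size_orbit_word. Qed.

(** Strands with the same letter never cross because [S] is increasing on each block, and the [L]
    block comes first. *)
Lemma top_order_only_LR_cross : pairwise (only_LR_cross orbit_word) (top_order orbit_word).
Proof.
have : pairwise ltn (map orbit_pos (top_order orbit_word)).
  by rewrite map_orbit_pos_top_order -(sorted_pairwise ltn_trans) iota_ltn_sorted.
rewrite pairwise_map; apply: (@sub_in_pairwise _ (gtn m)) => [x y xm ym /= xy|].
  rewrite /only_LR_cross !strand_bot_orbit_word // !strand_isL_orbit_word //.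
  apply/implyP => Syx; rewrite -leqNgt.
  case: (ltnP (orbit_pos x) p) => px; last first.
    by have := S_monoR px xy (orbit_pos_lt y); lia.
  case: leqP => // py; by have := S_monoL xy py; lia.
by apply/allP => x; rewrite mem_top_order.
Qed.

Lemma perm_strand_bot_top_order :
  perm_eq (map (strand_bot orbit_word) (top_order orbit_word)) (iota 0 m).
Proof.
have pt : perm_eq (top_order orbit_word) (iota 0 m).
  by rewrite perm_sort size_orbit_word.
apply: perm_trans (perm_map _ pt) _.
(* Each strand ends where the next one starts, cyclically. *)
have -> : map (strand_bot orbit_word) (iota 0 m) = rot 1 (map orbit_pos (iota 0 m)).
  apply: (@eq_from_nth _ 0) => [|j]; first by rewrite size_rot !size_map.
  rewrite size_map size_iota => jm.
  rewrite (nth_map 0) ?size_iota // nth_iota // add0n strand_bot_orbit_word //.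
  rewrite -map_rot (nth_map 0) ?size_rot ?size_iota //.
  have m0 : 0 < m by lia.
  case: m m0 jm orbit_pos_period => // n _ jm per.
  rewrite -[iota 0 n.+1]/(0 :: iota 1 n) rot1_cons nth_rcons size_iota.
  move: jm; rewrite ltnS leq_eqVlt => /orP[/eqP->|jn]; last by rewrite jn nth_iota.
  by rewrite ltnn eqxx; apply: per.
by rewrite perm_rot orbit_pos_perm.
Qed.

Lemma burau_orbit_word phi (i : 'I_m) :
  (burau m (modular_braid orbit_word) *m \col_j phi (j : nat))%R i 0%R =
  ball S phi i (iota i.+1 (m - i.+1)).
Proof.
have szt : size (top_order orbit_word) = m by rewrite size_sort size_iota size_orbit_word.
have inv := top_order_only_LR_cross.
rewrite /modular_braid size_orbit_word burau_col; last first.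
  by apply: bubble_iter_gens; rewrite // szt.
rewrite mxE burau_word_act_iter ?szt //; last first.
- exact: bubble_iter_sorted.
- exact: perm_strand_bot_top_order.
rewrite ball_at_nth ?szt //.
set x := nth _ _ _.
have E := map_orbit_pos_top_order.
have xi : orbit_pos x = i.
  by rewrite /x -(nth_map 0 0) ?szt // E nth_iota.
(* Strands named by their time in the orbit are renamed by their top point. *)
rewrite (@ball_map _ S orbit_pos); last first.
  move=> y; rewrite inE => H; rewrite strand_bot_orbit_word // -mem_top_order.
  by case/orP: H => [/eqP->|/mem_drop//]; rewrite mem_nth ?szt.
by rewrite xi map_drop E drop_iota add0n.
Qed.

End LorenzPermutation.

(** * Determinants *)

Local Open Scope ring_scope.

(** Sylvester's identity, from two factorizations of one block matrix. *)
Lemma det_1BmxC (R : comNzRingType) m n (A : 'M[R]_(m, n)) (B : 'M[R]_(n, m)) :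
  \det (1%:M - A *m B) = \det (1%:M - B *m A).
Proof.
have E : block_mx 1%:M A 0 1%:M *m block_mx (1%:M - A *m B) 0 B 1%:M =
         block_mx 1%:M 0 B 1%:M *m block_mx 1%:M A 0 (1%:M - B *m A).
  by rewrite !mulmx_block !(mul1mx, mul0mx, mulmx1, mulmx0, addr0, add0r) subrK addrC subrK.
have := congr1 determinant E.
by rewrite !det_mulmx !det_ublock !det_lblock !det1 !mul1r !mulr1.
Qed.

Lemma det_mx22 (R : comNzRingType) (M : 'M[R]_2) :
  \det M = M 0 0 * M 1 1 - M 0 1 * M 1 0.
Proof.
rewrite (expand_det_row _ 0) !big_ord_recl big_ord0 /cofactor !det_mx11 !mxE /=.
rewrite expr0 expr1 addr0 !mul1r mulN1r mulrN.
by congr (_ * M _ _ - M _ _ * M _ _); apply: val_inj.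
Qed.

(* Along a permutation [s] with a nonzero product, [tau] can only grow, whereas its
   total does not change: only [s = 1] contributes to the determinant. *)
Lemma det_unipotent (R : comNzRingType) n (T : 'M[R]_n) (tau : 'I_n -> nat) :
  (forall x, T x x = 1) ->
  (forall x y, x != y -> (tau y <= tau x)%N -> T x y = 0) -> \det T = 1.
Proof.
move=> T1 T0; rewrite /determinant (bigD1 (1%g : {perm 'I_n})) //= odd_perm1 mul1r.
rewrite (eq_bigr (fun=> 1)) => [|i _]; last by rewrite perm1.
rewrite big1_eq big1 ?addr0 // => s s1.
suff [x sx] : exists x, (x != s x) && (tau (s x) <= tau x)%N.
  by rewrite (bigD1 x) //= T0 ?mul0r ?mulr0 //; case/andP: sx.
apply/existsP; apply: contraR s1; rewrite negb_exists => /forallP H.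
have le x : (tau x <= tau (s x))%N.
  by have := H x; case: eqVneq => [<- //|_ /=]; rewrite -ltnNge => /ltnW.
have eqsum : (\sum_x tau x = \sum_x tau (s x))%N by rewrite (reindex_inj (@perm_inj _ s)).
apply/eqP/permP => x; rewrite perm1.
have := H x; case: eqVneq => [<- //|_ /=]; rewrite -ltnNge => lt.
suff : (\sum_x tau x < \sum_x tau (s x))%N by rewrite -eqsum ltnn.
rewrite (bigD1 x) //= [X in (_ < X)%N](bigD1 x) //=.
by rewrite -addSn leq_add // leq_sum.
Qed.

(** Matrix determinant lemma: [T - U *m V = T *m (1%:M - H *m V)], where [H] stands for the inverse
    of [T] times [U]. *)
Lemma det_unipotent_subM (R : comUnitRingType) n q (T : 'M[R]_n) (U H : 'M_(n, q)) (V : 'M_(q, n)) :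
  \det T = 1 -> T *m H = U -> \det (T - U *m V) = \det (1%:M - V *m H).
Proof.
move=> T1 <-; rewrite -mulmxA -{1}[T]mulmx1 -mulmxBr det_mulmx T1 mul1r.
exact: det_1BmxC.
Qed.

Local Close Scope ring_scope.

(** * Twisted torus knots *)

Section TwistedTorusKnot.
Variable k : nat.

(* Top point [x] goes to bottom point [twist_next x]: the first [12 * k + 1] strands begin
   with [L] (the first [6 * k] of them passing over 3 strands, the others over all 6), the
   last 6 strands begin with [R]. *)
Definition twist_next x :=
  if x < 6 * k then x + 3
  else if x < 12 * k + 1 then x + 6
  else if x < 12 * k + 4 then x - (12 * k + 1)
  else x - (6 * k + 1).

(* The number of steps from [12 * k + 6], the last [R] point, to the [c]-th [R] point. *)
Definition R_time c := (5 - c) * k.+1 + (2 - c) * (2 * k).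

(** The time of the [R] point that feeds the class of [x], one step to leave that point, and the
    jumps by 3 or 6 made since; in the high block, classes below 3 have already made [2 * k] jumps
    by 3. *)
Definition twist_time x :=
  if x < 6 * k then R_time (x %% 3) + 1 + x %/ 3
  else if x < 12 * k + 1 then
    let c := (x - 6 * k) %% 6 in
    R_time c + 1 + (x - 6 * k) %/ 6 + (if c < 3 then 2 * k else 0)
  else R_time (x - (12 * k + 1)).

Lemma twist_next_lt x : x < 12 * k + 7 -> twist_next x < 12 * k + 7.
Proof. by rewrite /twist_next; do !case: ifP; lia. Qed.

Lemma twist_next_monoL x y : x < y -> y < 12 * k + 1 -> twist_next x < twist_next y.
Proof. by rewrite /twist_next; do !case: ifP; lia. Qed.

Lemma twist_next_monoR x y : 12 * k + 1 <= x -> x < y -> y < 12 * k + 7 ->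
  twist_next x < twist_next y.
Proof. by rewrite /twist_next; do !case: ifP; lia. Qed.

(** Coordinates that avoid division: on [L] points, [c] is the class under jumps by 3 or 6 and [i]
    counts the jumps within the block. The indices are a point, its image and its time. *)
Variant position_spec : nat -> nat -> nat -> Prop :=
  | LowL c i of c < 3 & i < 2 * k : position_spec (3 * i + c) (3 * i + c + 3) (R_time c + 1 + i)
  | HighL c i of c < 6 & 6 * k + 6 * i + c < 12 * k + 1 :
      position_spec (6 * k + 6 * i + c) (6 * k + 6 * i + c + 6)
        (R_time c + 1 + i + (if c < 3 then 2 * k else 0))
  | RStrand c of c < 6 :
      position_spec (12 * k + 1 + c) (if c < 3 then c else 6 * k + c) (R_time c).

Lemma positionP x : x < 12 * k + 7 -> position_spec x (twist_next x) (twist_time x).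
Proof.
move=> xm; rewrite /twist_next /twist_time.
case: ifP => [x6k|].
  by rewrite {1 2}(divn_eq x 3) mulnC; constructor; lia.
case: ifP => [xp x6k|xp _].
  have E : x = 6 * k + 6 * ((x - 6 * k) %/ 6) + (x - 6 * k) %% 6 by lia.
  by rewrite {1 2}E; constructor; lia.
have E : x = 12 * k + 1 + (x - (12 * k + 1)) by lia.
have -> : (if x < 12 * k + 4 then x - (12 * k + 1) else x - (6 * k + 1)) =
    (if x - (12 * k + 1) < 3 then x - (12 * k + 1) else 6 * k + (x - (12 * k + 1))).
  by do !case: ifP; lia.
by rewrite {1}E; constructor; lia.
Qed.

Lemma R_timeE c : c < 6 ->
  R_time c = if c < 3 then 9 * k + 5 - c * (3 * k + 1) else (5 - c) * k.+1.
Proof. by rewrite /R_time; case: c => [|[|[|[|[|[|c]]]]]] //= _; lia. Qed.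

Lemma twist_time_low c i : c < 3 -> i < 2 * k -> twist_time (3 * i + c) = R_time c + 1 + i.
Proof.
move=> c3 ik; rewrite /twist_time ifT; last by lia.
have -> : (3 * i + c) %% 3 = c by lia.
by have -> : (3 * i + c) %/ 3 = i by lia.
Qed.

Lemma twist_time_high c i : c < 6 -> 6 * k + 6 * i + c < 12 * k + 1 ->
  twist_time (6 * k + 6 * i + c) = R_time c + 1 + i + (if c < 3 then 2 * k else 0).
Proof.
move=> c6 ik; rewrite /twist_time ifF; last by lia.
rewrite ik /=; have -> : (6 * k + 6 * i + c - 6 * k) %% 6 = c by lia.
by have -> : (6 * k + 6 * i + c - 6 * k) %/ 6 = i by lia.
Qed.

Lemma twist_time_R c : twist_time (12 * k + 1 + c) = R_time c.
Proof. by rewrite /twist_time !ifF ?addKn //; lia. Qed.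

Lemma twist_time_lt x : x < 12 * k + 7 -> twist_time x < 12 * k + 7.
Proof.
move=> xm; case: (positionP xm) => [c i c3 ik|c i c6 ik|c c6]; rewrite R_timeE; try lia.
- by move: c3; case: c => [|[|[|c]]] //=; lia.
- by move: c6 ik; case: c => [|[|[|[|[|[|c]]]]]] //=; lia.
- by move: c6; case: c => [|[|[|[|[|[|c]]]]]] //=; lia.
Qed.

Lemma twist_time_next x : 0 < k -> x < 12 * k + 7 -> twist_next x != 12 * k + 6 ->
  twist_time (twist_next x) = (twist_time x).+1.
Proof.
move=> k0 xm; case: (positionP xm) => [c i c3 ik _|c i c6 ik|c c6 _].
- have -> : 3 * i + c + 3 = 3 * i.+1 + c by lia.
  have [ik'|ik'] := ltnP i.+1 (2 * k); first by rewrite twist_time_low //; lia.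
  have -> : 3 * i.+1 + c = 6 * k + 6 * 0 + c by lia.
  by rewrite twist_time_high ?c3 /=; lia.
- have -> : 6 * k + 6 * i + c + 6 = 6 * k + 6 * i.+1 + c by lia.
  have [ik'|ik'] := ltnP (6 * k + 6 * i.+1 + c) (12 * k + 1).
    by move=> _; rewrite twist_time_high //; lia.
  (* Class 0 would jump to the excluded point [12 * k + 6]; any other class ends on the [R] point of
     index [c.-1]. *)
  have [c0 /eqP[]|c0 _] := posnP c; first by lia.
  have -> : 6 * k + 6 * i.+1 + c = 12 * k + 1 + c.-1 by lia.
  rewrite twist_time_R !R_timeE; try lia.
  by move: c6 c0 ik ik'; case: c => [|[|[|[|[|[|c]]]]]] //=; lia.
- case: ifP => c3; first by rewrite -[c in twist_time c]add0n -[0](muln0 3) twist_time_low ?c3 /=; lia.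
  by rewrite -[6 * k]addn0 -[X in _ + X + _](muln0 6) twist_time_high ?c3 /=; lia.
Qed.

Lemma twist_time_last x : x < 12 * k + 7 -> twist_next x = 12 * k + 6 ->
  twist_time x = (12 * k + 7).-1.
Proof.
move=> xm; case: (positionP xm) => [c i c3 ik|c i c6 ik|c c6]; try by case: ifP; lia.
- by lia.
- move=> E; have [c0 ik'] : c = 0 /\ i = k by lia.
  by rewrite c0 ik' R_timeE //=; lia.
Qed.

Lemma twist_time_z : twist_time (12 * k + 6) = 0.
Proof. by rewrite -[6]/(1 + 5) addnA twist_time_R. Qed.

Definition twist_word := orbit_word (12 * k + 7) (12 * k + 1) (12 * k + 6) twist_next.

Lemma size_twist_word : size twist_word = 12 * k + 7.
Proof. exact: size_orbit_word. Qed.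

Lemma twist_word_primitive : 0 < k -> primitive twist_word.
Proof.
move=> k0; apply: (@orbit_word_primitive _ _ _ _ twist_time); first by lia.
- exact: twist_next_lt.
- exact: twist_next_monoL.
- exact: twist_next_monoR.
- exact: twist_time_lt.
- exact: twist_time_z.
- by move=> x; apply: twist_time_next.
- exact: twist_time_last.
Qed.

Local Open Scope ring_scope.

Lemma burau_twist_word M phi (i : 'I_M) : (0 < k)%N -> M = (12 * k + 7)%N ->
  (burau M (modular_braid twist_word) *m \col_j phi (j : nat)) i 0 =
  ball twist_next phi i (iota i.+1 (M - i.+1)).
Proof.
move=> k0 EM; rewrite /twist_word -EM.
apply: (@burau_orbit_word _ (12 * k + 1) (12 * k + 6) twist_next twist_time);
  rewrite ?EM; first by lia.
- exact: twist_next_lt.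
- exact: twist_next_monoL.
- exact: twist_next_monoR.
- exact: twist_time_lt.
- exact: twist_time_z.
- by move=> x; apply: twist_time_next.
- exact: twist_time_last.
Qed.

(** The contribution of the falls: the ball passes [l] of the [R] strands with weight [tF ^+ l],
    then falls onto the next with weight [1 - tF]. *)
Definition drop_sum (phi : nat -> F) n : F :=
  (1 - tF) * \sum_(l < n) tF ^+ l * phi (twist_next (12 * k + 1 + l)).

(** The [R] strands land on [0, 1, 2] and on [6 * k + 3] to [6 * k + 5]. A jump by 3 from below
    [6 * k] lands between these two groups, a jump by 6 from the other [L] points lands beyond
    both. *)
Lemma ball_twist phi i : (i < 12 * k + 7)%N ->
  ball twist_next phi i (iota i.+1 (12 * k + 7 - i.+1)) =
  if (i < 6 * k)%N then drop_sum phi 3 + tF ^+ 3 * phi (twist_next i)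
  else if (i < 12 * k + 1)%N then drop_sum phi 6 + tF ^+ 6 * phi (twist_next i)
  else phi (twist_next i).
Proof.
move=> im; case: (ltnP i (12 * k + 1)) => ip; last first.
  rewrite ifF ?ball_nocross //; last by lia.
  by apply/allP => y; rewrite mem_iota => yi; rewrite ltnW // twist_next_monoR //; lia.
have -> : (12 * k + 7 - i.+1 = (12 * k + 1 - i.+1) + 6)%N by lia.
rewrite iotaD ball_cat_nocross; last first.
  by apply/allP => y; rewrite mem_iota => yi; rewrite ltnW // twist_next_monoL //; lia.
rewrite subnKC // -{1}[(12 * k + 1)%N]addn0 iotaDl [iota 0 6]/=.
rewrite /drop_sum !big_ord_recr !big_ord0 /=.
have nR c : (c < 6)%N -> twist_next (12 * k + 1 + c) = if (c < 3)%N then c else (6 * k + c)%N.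
  by move=> c6; rewrite /twist_next; do !case: ifP; lia.
rewrite /= !nR //=.
have [i6|i6] := ltnP i (6 * k).
  have -> : twist_next i = (i + 3)%N by rewrite /twist_next i6.
  by do 3 (rewrite ifT; last by lia); do 3 (rewrite ifF; last by lia); ring.
have -> : twist_next i = (i + 6)%N by rewrite /twist_next ip ifF //; lia.
by do 6 (rewrite ifT; last by lia); ring.
Qed.

Local Notation n := (12 * k + 6)%N.
Local Notation delta y := (fun j : nat => (j == y)%:R : F).

(* With the last point deleted, the Alexander matrix is [ride_mx - fall_mx *m drop_mx]:
   a ball on an [L] strand either rides to its end, or falls onto an [R] strand in one
   of only two ways. *)
Definition ride_weight x : F :=
  if (x < 6 * k)%N then tF ^+ 3 else if (x < 12 * k + 1)%N then tF ^+ 6 else 1.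

Definition ride_mx : 'M[F]_n :=
  \matrix_(x, y) ((x == y)%:R - ride_weight x * delta y (twist_next x)).

Definition fall_type (c : 'I_2) x : F :=
  if c == 0 then (x < 6 * k)%N%:R else (6 * k <= x < 12 * k + 1)%N%:R.

Definition fall_mx : 'M[F]_(n, 2) := \matrix_(x, c) fall_type c x.

Definition drop_mx : 'M[F]_(2, n) :=
  \matrix_(c, y) drop_sum (delta y) (if c == 0 then 3 else 6).

Lemma sum_ord2 (f : 'I_2 -> F) : \sum_c f c = f 0 + f 1.
Proof. by rewrite !big_ord_recl big_ord0 addr0; congr (f _ + f _); apply: val_inj. Qed.

Lemma alex_det_twist_word : (0 < k)%N ->
  alex_det twist_word = \det (ride_mx - fall_mx *m drop_mx).
Proof.
move=> k0; have sz : size twist_word = n.+1 by rewrite size_twist_word; lia.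
rewrite /alex_det sz /=; congr determinant; apply/matrixP => x y.
rewrite !mxE sum_ord2 !mxE (_ : (widen_ord _ x == widen_ord _ y) = (x == y)) //.
set B := burau _ _.
(* Entries are read off by testing the matrix on indicator columns. *)
have E (i j : 'I_n.+1) : B i j = (B *m \col_l delta j l) i 0.
  rewrite mxE (bigD1 j) //= mxE eqxx mulr1 big1 ?addr0 // => l lj.
  by rewrite mxE val_eqE (negbTE lj) mulr0.
rewrite E (burau_twist_word (delta y)) //; last by lia.
rewrite /= (_ : n.+1 - x.+1 = 12 * k + 7 - x.+1)%N; last by lia.
rewrite ball_twist /=; last by have := ltn_ord x; lia.
rewrite /ride_weight /fall_type /=.
have [xk|xk] := ltnP x (6 * k); first by rewrite /= mul1r mul0r; ring.
by case: ltnP => xp /=; ring.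
Qed.

(** Deleting the last point cuts the cycle open, so [twist_time] increases along every nonzero
    off-diagonal entry. *)
Lemma det_ride_mx : (0 < k)%N -> \det ride_mx = 1.
Proof.
move=> k0; apply: (det_unipotent (tau := fun x : 'I_n => twist_time x)) => [x|x y xy le].
  rewrite mxE eqxx (_ : (twist_next x == x) = false) ?mulr0 ?subr0 //.
  by have := ltn_ord x; rewrite /twist_next; do !case: ifP; lia.
rewrite mxE (negbTE xy) (_ : (twist_next x == y) = false) ?mulr0 ?subr0 //.
have xn := ltn_ord x; have yn := ltn_ord y.
apply/negP => /eqP E; move: le; rewrite -E twist_time_next ?ltnn //; first by lia.
by rewrite E; lia.
Qed.

End TwistedTorusKnot.

(** * The Alexander polynomial in closed form *)

Local Open Scope ring_scope.

(* [t^-6 Y^-2] times the determinant of [alex_value_det], reduced by [t^6 K = K + Y - 1],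
   where [K] and [Y] stand for [1 + t^6 + ... + t^(6 (k - 1))] and [t^(6 k)]. *)
Definition alex_value (R : comNzRingType) (t K Y : R) : R :=
  (1 - t) * K
  + Y * ((t - t ^+ 2) * K + (1 - 2%:R * t + t ^+ 2 + t ^+ 3 - 2%:R * t ^+ 4 + t ^+ 5) * K ^+ 2)
  + Y ^+ 2 * ((- t + t ^+ 2 - t ^+ 3) * K
      + (2%:R - t - t ^+ 2 + 2%:R * t ^+ 3 - t ^+ 4 - t ^+ 5) * K ^+ 2
    + Y * ((1 - t ^+ 2 + t ^+ 3 - t ^+ 4) * K
      + (2%:R - t - t ^+ 2 + 2%:R * t ^+ 3 - t ^+ 4 - t ^+ 5) * K ^+ 2)
    + Y ^+ 2 * ((2%:R - 2%:R * t + t ^+ 2 - t ^+ 4) * K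
      + (1 + t - 2%:R * t ^+ 2 + t ^+ 3 + t ^+ 4 - 2%:R * t ^+ 5) * K ^+ 2)
    + Y ^+ 3 * ((2%:R + t - 2%:R * t ^+ 2 + t ^+ 3 - t ^+ 5) * K)
    + Y ^+ 4 * ((1 - t ^+ 5) * K)
    + Y ^+ 5).

Lemma rmorph_alex_value (R S : comNzRingType) (f : {rmorphism R -> S}) t K Y :
  f (alex_value t K Y) = alex_value (f t) (f K) (f Y).
Proof.
by rewrite /alex_value !(rmorphD, rmorphB, rmorphN, rmorphM, rmorphXn, rmorph1, rmorph_nat).
Qed.

(** [q0 a b] to [q5 a b] are the solution of the ride system where the six [R] strands land, for the
    right-hand side [a] on the first [6 * k] points and [b] on the other [L] points; [d3] and [d6]
    are its fall sums. Eliminating [Y] leaves a formal identity in [t] and [K]. *)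
Lemma alex_value_det (R : comNzRingType) (t K : R) :
  let Y := 1 - (1 - t ^+ 6) * K in
  let q0 a b := a * ((1 + t ^+ 3) * K) + Y * (b * K + Y * b) in
  let q1 a b := a * ((1 + t ^+ 3) * K) + Y * (b * K + Y * q0 a b) in
  let q2 a b := a * ((1 + t ^+ 3) * K) + Y * (b * K + Y * q1 a b) in
  let q3 a b := b * K + Y * q2 a b in
  let q4 a b := b * K + Y * q3 a b in
  let q5 a b := b * K + Y * q4 a b in
  let d3 a b := (1 - t) * (q0 a b + t * q1 a b + t ^+ 2 * q2 a b) in
  let d6 a b := (1 - t) * (q0 a b + t * q1 a b + t ^+ 2 * q2 a b
    + t ^+ 3 * q3 a b + t ^+ 4 * q4 a b + t ^+ 5 * q5 a b) in
  (1 - d3 1 0) * (1 - d6 0 1) - d3 0 1 * d6 1 0 = t ^+ 6 * Y ^+ 2 * alex_value t K Y.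
Proof. rewrite /alex_value /=; ring. Qed.

Section TwistedTorusKnotDet.
Variable k : nat.
Hypothesis k_gt0 : (0 < k)%N.
Local Notation n := (12 * k + 6)%N.
Local Notation t := tF.
Local Notation K := (\sum_(i < k) t ^+ (6 * i)).
Local Notation Y := (t ^+ (6 * k)).

(* [h] is a column of [invmx ride_mx *m fall_mx]. *)
Section Values.
Variables (a b : F) (h : nat -> F).
Hypothesis h_n : h n = 0.
Hypothesis h_next : forall x, (x < n)%N ->
  h x = a * (x < 6 * k)%N%:R + b * (6 * k <= x < 12 * k + 1)%N%:R
        + ride_weight k x * h (twist_next k x).

(** Unrolling [2 * k] jumps by 3 gives a geometric sum of ratio [t ^+ 3], whose terms pair up into
    [(1 + t ^+ 3) * K]. *)
Lemma value_low c : (c < 3)%N ->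
  h c = a * ((1 + t ^+ 3) * K) + Y * h (6 * k + c)%N.
Proof.
move=> c3.
have H j : (j <= 2 * k)%N ->
    h c = a * (\sum_(i < j) t ^+ (3 * i)) + t ^+ (3 * j) * h (3 * j + c)%N.
  elim: j => [|j IH] jk; first by rewrite big_ord0 muln0 mulr0 add0r mul1r.
  rewrite IH; last by lia.
  have xk : (3 * j + c < 6 * k)%N by lia.
  rewrite h_next; last by lia.
  rewrite /ride_weight /twist_next xk (_ : (6 * k <= 3 * j + c)%N = false) /=; last by lia.
  have -> : (3 * j + c + 3 = 3 * j.+1 + c)%N by lia.
  by rewrite big_ord_recr /= [(3 * j.+1)%N]mulnS exprD; ring.
rewrite (H _ (leqnn _)) (_ : 3 * (2 * k) = 6 * k)%N; last by lia.
congr (a * _ + _); rewrite mulr_sumr.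
elim: k => [|j IH]; first by rewrite muln0 !big_ord0.
rewrite mulnS /= !big_ord_recr /= IH.
rewrite (_ : 3 * (2 * j) = 6 * j)%N; last by lia.
rewrite (_ : 3 * (2 * j).+1 = 6 * j + 3)%N; last by lia.
by rewrite exprD; ring.
Qed.

Lemma value_high c : (c < 6)%N ->
  h (6 * k + c)%N = b * K + Y * h (12 * k + c)%N.
Proof.
move=> c6.
have H j : (j <= k)%N ->
    h (6 * k + c)%N = b * (\sum_(i < j) t ^+ (6 * i)) + t ^+ (6 * j) * h (6 * k + 6 * j + c)%N.
  elim: j => [|j IH] jk; first by rewrite big_ord0 muln0 addn0 mulr0 add0r mul1r.
  rewrite IH; last by lia.
  rewrite h_next; last by lia.
  have x6k : (6 * k + 6 * j + c < 6 * k)%N = false by lia.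
  have k6x : (6 * k <= 6 * k + 6 * j + c)%N by lia.
  have xp : (6 * k + 6 * j + c < 12 * k + 1)%N by lia.
  rewrite /ride_weight /twist_next x6k k6x xp /=.
  have -> : (6 * k + 6 * j + c + 6 = 6 * k + 6 * j.+1 + c)%N by lia.
  by rewrite big_ord_recr /= [(6 * j.+1)%N]mulnS exprD; ring.
by rewrite (H _ (leqnn _)) (_ : 6 * k + 6 * k + c = 12 * k + c)%N //; lia.
Qed.

(** The next point is the deleted one, where [h] vanishes; the recursion starts here. *)
Lemma value_12k : h (12 * k)%N = b.
Proof.
rewrite h_next; last by lia.
have x6k : (12 * k < 6 * k)%N = false by lia.
have k6x : (6 * k <= 12 * k)%N by lia.
have xp : (12 * k < 12 * k + 1)%N by lia.
by rewrite /twist_next x6k k6x xp /= h_n; ring.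
Qed.

Lemma value_R c : (c < 5)%N ->
  h (12 * k + c.+1)%N = h (if (c < 3)%N then c else (6 * k + c)%N).
Proof.
move=> c5; rewrite h_next; last by lia.
have x6k : (12 * k + c.+1 < 6 * k)%N = false by lia.
have xp : (12 * k + c.+1 < 12 * k + 1)%N = false by lia.
rewrite /ride_weight /twist_next x6k xp andbF !mulr0 !add0r mul1r; congr h.
by do !case: ifP; lia.
Qed.

(** Class 0 ends at [12 * k], and class [c.+1] runs into the [R] point of index [c], which leads to
    the start of class [c]: each value follows from the preceding one. *)
Lemma values :
  let q0 := a * ((1 + t ^+ 3) * K) + Y * (b * K + Y * b) in
  let q1 := a * ((1 + t ^+ 3) * K) + Y * (b * K + Y * q0) in
  let q2 := a * ((1 + t ^+ 3) * K) + Y * (b * K + Y * q1) in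
  let q3 := b * K + Y * q2 in
  let q4 := b * K + Y * q3 in
  let q5 := b * K + Y * q4 in
  drop_sum k h 3 = (1 - t) * (q0 + t * q1 + t ^+ 2 * q2) /\
  drop_sum k h 6 = (1 - t) * (q0 + t * q1 + t ^+ 2 * q2 + t ^+ 3 * q3 + t ^+ 4 * q4 + t ^+ 5 * q5).
Proof.
move=> q0 q1 q2 q3 q4 q5.
have nR c : (c < 6)%N -> twist_next k (12 * k + 1 + c) = if (c < 3)%N then c else (6 * k + c)%N.
  by move=> c6; rewrite /twist_next; do !case: ifP; lia.
have e0 : h 0 = q0 by rewrite value_low // value_high // addn0 value_12k.
have e1 : h 1 = q1 by rewrite value_low // value_high // value_R // e0.
have e2 : h 2 = q2 by rewrite value_low // value_high // value_R // e1.
have e3 : h (6 * k + 3)%N = q3 by rewrite value_high // value_R // e2.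
have e4 : h (6 * k + 4)%N = q4 by rewrite value_high // value_R // e3.
have e5 : h (6 * k + 5)%N = q5 by rewrite value_high // value_R // e4.
rewrite /drop_sum !big_ord_recr !big_ord0 /= !nR //= e0 e1 e2 e3 e4 e5.
by rewrite !add0r expr0 expr1 mul1r.
Qed.

End Values.

Lemma sum_delta (phi : nat -> F) z : (z < n)%N ->
  \sum_(y < n) (z == y)%:R * phi y = phi z.
Proof.
move=> zn; rewrite (bigD1 (Ordinal zn)) //= eqxx mul1r big1 ?addr0 // => y.
by rewrite -val_eqE /= eq_sym => /negbTE->; rewrite mul0r.
Qed.

Lemma geometric_sum : Y = 1 - (1 - t ^+ 6) * K.
Proof.
under eq_bigr => i _ do rewrite exprM.
by rewrite exprM -[1 - _ ^+ 6]opprB mulNr -subrX1; ring.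
Qed.

Lemma alex_det_twist_wordE :
  alex_det (twist_word k) = t ^+ n * alex_value t K Y.
Proof.
rewrite alex_det_twist_word //.
have T1 := det_ride_mx k_gt0.
pose H := invmx (ride_mx k) *m fall_mx k.
have TH : ride_mx k *m H = fall_mx k.
  by rewrite mulKVmx // unitmxE T1 unitr1.
rewrite (det_unipotent_subM _ T1 TH).
(* The default 0 is the value needed at the deleted point [n]. *)
pose h c x := if insub x is Some i then H i c else 0.
have hE c (x : 'I_n) : h c x = H x c by rewrite /h valK.
have hn c : h c n = 0 by rewrite /h insubF // ltnn.
have hnext c x : (x < n)%N ->
    h c x = fall_type k c x + ride_weight k x * h c (twist_next k x).
  move=> xn; have := congr1 (fun M : 'M_(n, 2) => M (Ordinal xn) c) TH.
  rewrite !mxE => <-; rewrite -[x in h c x]/(val (Ordinal xn)) hE.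
  under eq_bigr => y _ do rewrite mxE -hE mulrBl -mulrA.
  rewrite big_split /= sumrN -mulr_sumr.
  rewrite (sum_delta (h c) xn) -[x in h c x]/(val (Ordinal xn)) hE.
  have [Sn|Sn] := ltnP (twist_next k x) n; first by rewrite sum_delta // subrK.
  have -> : twist_next k x = n.
    by apply/eqP; rewrite eqn_leq Sn andbT -ltnS; have := @twist_next_lt k x; lia.
  rewrite hn mulr0 addr0 big1 ?mulr0 ?subr0 // => y _.
  by rewrite gtn_eqF ?mul0r.
have dropE c c' : (drop_mx k *m H) c c' = drop_sum k (h c') (if c == 0 then 3 else 6).
  rewrite mxE /drop_sum.
  under eq_bigr => y _ do rewrite mxE -hE /drop_sum -mulrA mulr_suml.
  rewrite -mulr_sumr exchange_big /=; congr (_ * _); apply: eq_bigr => l _.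
  under eq_bigr => y _ do rewrite -mulrA.
  rewrite -mulr_sumr sum_delta //.
  have lr : (l < 6)%N by apply: leq_trans (ltn_ord l) _; case: (c == 0).
  by move: (nat_of_ord l) lr => j j6; rewrite /twist_next; do !case: ifP; clear l; lia.
(* Column 0 of [fall_mx] is 1 on the first [6 * k] points, column 1 on the other [L] points. *)
have [|d03 d06] := @values 1 0 (h 0) (hn 0).
  by move=> x xn; rewrite hnext // /fall_type /= mul1r mul0r addr0.
have [|d13 d16] := @values 0 1 (h 1) (hn 1).
  by move=> x xn; rewrite hnext // /fall_type /= mul1r mul0r add0r.
have E (c c' : 'I_2) : (1%:M - drop_mx k *m H) c c' = (c == c')%:R - drop_sum k (h c') (if c == 0 then 3 else 6).
  by rewrite -dropE !mxE.
rewrite det_mx22 !E /= d03 d06 d13 d16 !sub0r mulrNN.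
(* This splits [t ^+ n] into the factor [t ^+ 6 * Y ^+ 2] of [alex_value_det]. *)
rewrite (_ : n = 6 + 6 * k * 2)%N; last by lia.
rewrite exprD (exprM t (6 * k) 2) geometric_sum -alex_value_det.
by [].
Qed.

Definition alex_poly : {poly int} :=
  alex_value 'X (\sum_(i < k) 'X^(6 * i)) 'X^(6 * k).

Lemma alex_det_twist_word_poly :
  alex_det (twist_word k) = tF ^+ n * polyF alex_poly.
Proof.
rewrite alex_det_twist_wordE /polyF rmorph_alex_value rmorphXn rmorph_sum.
by under [in RHS]eq_bigr => i _ do rewrite rmorphXn.
Qed.

Lemma horner_alex_poly (u : int) :
  alex_poly.[u] = alex_value u (\sum_(i < k) u ^+ (6 * i)) (u ^+ (6 * k)).
Proof.
rewrite -/(horner_eval u alex_poly) rmorph_alex_value rmorph_sum rmorphXn.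
have hX : (horner_eval u : {rmorphism {poly int} -> int}) 'X = u by exact: hornerX.
by under eq_bigr => i _ do rewrite rmorphXn hX; rewrite hX.
Qed.

Lemma twist_word_alexander_poly : is_alexander_poly (twist_word k) alex_poly.
Proof.
split; last split.
(* At 0, [Y] vanishes and the sum [K] is reduced to its first term 1, so the constant term is 1. *)
- rewrite horner_alex_poly (_ : 0 ^+ _ = 0); last by rewrite expr0n; case: k k_gt0.
  case: k k_gt0 => // j _; rewrite big_ord_recl /= big1 => [|i _].
    by rewrite /alex_value; apply/eqP; rewrite muln0 expr0; lia.
  by rewrite expr0n.
- rewrite horner_alex_poly !expr1n /alex_value; ring.
- exists false, n%:Z; rewrite expr0 mul1r; exact: alex_det_twist_word_poly.
Qed.

End TwistedTorusKnotDet.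

(** * Coefficients of the Alexander polynomial *)

Lemma coef_XnM_comp_Xn (R : nzRingType) (q : {poly R}) d j s i : (s < d)%N -> (i < d)%N ->
  ('X^i * (q \Po 'X^d))`_(d * j + s) = if s == i then q`_j else 0.
Proof.
move=> sd id; rewrite coefXnM coef_comp_poly_Xn; last exact: leq_ltn_trans sd.
have [->|si] := eqVneq s i.
  by rewrite ltnNge leq_addl /= addnK dvdn_mulr // mulKn //; apply: leq_ltn_trans id.
case: ltnP => // ile; case: ifP => // /dvdnP[c E]; case/eqP: si.
have : (d * j + s)%N = (c * d + i)%N by rewrite -E subnK.
by move/(congr1 (modn^~ d)); rewrite mulnC !modnMDl !modn_small.
Qed.

(** There are [j.+1] ways to write [j] as an ordered sum, and [j < n] keeps them all within
    range. *)
Lemma coef_allones_sqr (R : nzRingType) n j : (j < n)%N ->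
  ((\poly_(i < n) 1 : {poly R}) ^+ 2)`_j = j.+1%:R.
Proof.
move=> jn; rewrite expr2 coefM (eq_bigr (fun=> 1)) => [|i _].
  by rewrite sumr_const card_ord.
by rewrite !coef_poly !ifT ?mulr1 // ?(leq_ltn_trans (leq_subr _ _)) // (leq_ltn_trans _ jn) // -ltnS.
Qed.

(** The list is [(1 - t)^2 (1 + t^3)]. These degrees exceed that of [(1 - t) K] and stay below that
    of [Y ^+ 2], so only the terms linear in [Y] count; there the residue [s] selects the power of
    [t], and [K], [K ^+ 2] contribute 1 and [j.+1]. *)
Lemma coef_alex_poly j s : (s < 6)%N ->
  (alex_poly j.+1)`_(6 * j.+1 + (6 * j + s)) =
  (s == 1)%:R - (s == 2)%:R + j.+1%:R * [:: 1; -2; 1; 1; -2; 1]`_s.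
Proof.
move=> s6; rewrite /alex_poly.
have -> : \sum_(i < j.+1) 'X^(6 * i) = (\poly_(i < j.+1) 1 : {poly int}) \Po 'X^6.
  rewrite poly_def raddf_sum; apply: eq_bigr => i _ /=.
  by rewrite scale1r comp_Xn_poly exprM.
set q : {poly int} := \poly_(i < j.+1) 1.
set Y := 'X^(6 * j.+1); set K := q \Po 'X^6.
(* The powers ['X^0] and ['X^1] are kept explicit to match [coef_XnM_comp_Xn]; [Z] absorbs all that
   [Y ^+ 2] divides. *)
have [Z ->] : exists Z, alex_value 'X K Y =
    (K - 'X^1 * K) + Y * (('X^1 * K - 'X^2 * K) + ('X^0 * K ^+ 2 - ('X^1 * K ^+ 2) *+ 2
      + 'X^2 * K ^+ 2 + 'X^3 * K ^+ 2 - ('X^4 * K ^+ 2) *+ 2 + 'X^5 * K ^+ 2))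
    + Y ^+ 2 * Z.
  by eexists; rewrite /alex_value; congr (_ + _); ring.
have K2 : K ^+ 2 = q ^+ 2 \Po 'X^6 by rewrite !expr2 comp_polyM.
have qj : q`_j = 1 by rewrite coef_poly ltnSn.
have q2j : (q ^+ 2)`_j = j.+1%:R by rewrite coef_allones_sqr.
have K0 i : (i < 6)%N -> ('X^i * K)`_(6 * j.+1 + (6 * j + s)) = 0.
  move=> i6; rewrite addnA -mulnDr coef_XnM_comp_Xn //; case: ifP => // _.
  by rewrite coef_poly ltnNge leq_addr.
have KE : K = 'X^0 * K by rewrite expr0 mul1r.
rewrite !coefD coefN {1}KE !K0 //.
rewrite -exprM !coefXnM ltnNge leq_addr /= addKn ifT; last by lia.
rewrite K2 !(coefD, coefN, coefMn) !coef_XnM_comp_Xn // qj q2j.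
by case: s s6 {K0} => [|[|[|[|[|[|s]]]]]] //= _; lia.
Qed.

Theorem theorem8p1 :
  forall k : int, exists W : word,
    primitive W /\ (2 <= size W)%N /\
    exists p : {poly int}, is_alexander_poly W p /\
      exists d : nat, (d < size p)%N /\ p`_d = k.
Proof.
move=> c.
suff [j [s [s4 E]]] : exists j s, (s <= 4)%N /\
    c = (s == 1)%:R - (s == 2)%:R + j.+1%:R * [:: 1; -2; 1; 1; -2; 1]`_s.
  exists (twist_word j.+1); split; first exact: twist_word_primitive.
  split; first by rewrite size_twist_word; lia.
  exists (alex_poly j.+1); split; first exact: twist_word_alexander_poly.
  exists (6 * j.+1 + (6 * j + s))%N; split; last by rewrite coef_alex_poly ?E //; lia.
  (* The coefficient at [s = 4] is [-2 (j + 1)], never zero, so every degree with [s <= 4] is within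
     the size of the polynomial. *)
  rewrite ltnNge; apply/negP => sz.
  have : (alex_poly j.+1)`_(6 * j.+1 + (6 * j + 4)) = 0.
    by rewrite nth_default // (leq_trans sz) // !leq_add2l.
  by rewrite coef_alex_poly //=; lia.
(* For [s = 2, 1, 4] the coefficient is [j], [-(2 j + 1)] and [-2 (j + 1)]: all nonnegative,
   negative odd and negative even integers. In the negative case [c] is [-(n + 1)]. *)
case: c => n; first by exists n, 2%N; split=> //=; lia.
have [En|En] := boolP (odd n); last first.
  by exists n./2, 1%N; split=> //=; lia.
by exists n./2, 4%N; split=> //=; lia.
Qed.
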